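(* Let $a<b$, $\lambda,\gamma>0$, $p\in[1,\infty]$, and let $g\in\mathrm{BV}_{\mathrm{reg}}((a,b))$ be a non-decreasing function with at most $\alpha$-growth at the endpoints $a$ and $b$, i.e. there exist $\alpha>0$ and $C>0$ such that $g(x)-g^+(a)\le C(x-a)^\alpha$ and $g^-(b)-g(x)\le C(b-x)^\alpha$ for all $x\in(a,b)$. Let $H=g^-(b)-g^+(a)$. If $$\gamma\le\left(1+\frac1{p\alpha}\right)^{-1}=\frac{p\alpha}{p\alpha+1}\qquad\text{and}\qquad \lambda>2^{\frac{(p-1)\alpha+1}{p\alpha+1}}\,K(p,\alpha)^{-\gamma/p}\,C^{\gamma/(p\alpha)}\,H^{1-\gamma(1+1/(p\alpha))},$$ then $g$ is essentially the unique minimizer of the functional $$F:\mathrm{BV}((a,b))\to[0,\infty),\qquad F(u)=\mathrm{TV}(u)+\lambda\|u-g\|_p^\gamma,$$ in the sense that $g$ is a minimizer and any other minimizer coincides with $g$ outside of the jump set of $g$.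
   Context: For an interval $I$ and $u:I\to\mathbb{R}$, $\mathrm{TV}(u)=\mathrm{TV}(u;I)$ is the pointwise total variation, i.e. the supremum of $\sum_{i=1}^n|u(x_i)-u(x_{i-1})|$ over finite sequences $x_0\le\dots\le x_n$ in $I$. $\mathrm{BV}(I)$ is the set of functions $u:I\to\mathbb{R}$ (defined everywhere) with $\mathrm{TV}(u;I)<\infty$. Such functions have one-sided limits $u^\pm(x)=\lim_{y\to x^\pm}u(y)$. $\mathrm{BV}_{\mathrm{reg}}((a,b))$ is the set of $u\in\mathrm{BV}((a,b))$ that are regular: $u(x)$ lies between $u^-(x)$ and $u^+(x)$ (inclusive) for every $x\in(a,b)$. The jump set of $g$ is $\{x: g^-(x)\ne g^+(x)\}$. $\|\cdot\|_p$ is the $L^p$ norm on $(a,b)$. The constant is $$K(p,\alpha)=\frac{\Gamma(p+1)\,\Gamma(1/\alpha+1)}{\Gamma(p+1/\alpha+1)},$$ with $\Gamma$ Euler's Gamma function. For $p=\infty$ all expressions are interpreted as limits as $p\to\infty$: the conditions read $\gamma\le1$ and $\lambda>2H^{1-\gamma}$. *)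

(* Defs.v *)
From HB Require Import structures.
From mathcomp Require Import all_boot all_order all_algebra.
From mathcomp Require Import all_classical all_reals all_analysis.

Set Implicit Arguments.
Unset Strict Implicit.
Unset Printing Implicit Defensive.

Import Order.TTheory GRing.Theory Num.Theory.
Import numFieldNormedType.Exports.

Local Open Scope classical_set_scope.
Local Open Scope ring_scope.

(* A function on an interval I is represented by a total function R -> R; all
   the notions below depend only on its values on I. *)

(* Unlike [realfun.total_variation], I is an arbitrary interval, so the points
   of the subdivision are not required to reach the end points of I. *)
Definition pointwise_TV (R : realType) (I : interval R) (u : R -> R) : \bar R :=
  ereal_sup [set s | exists (n : nat) (x : nat -> R),
    [/\ forall i, (i <= n)%N -> x i \in I,
        forall i, (i < n)%N -> x i <= x i.+1 &
        s = (\sum_(i < n) `|u (x i.+1) - u (x i)|)%:E]].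

Definition bv (R : realType) (I : interval R) : set (R -> R) :=
  [set u | (pointwise_TV I u < +oo)%E].

Definition right_lim (R : realType) (u : R -> R) (x : R) : R :=
  lim (u y @[y --> x^'+]).

Definition left_lim (R : realType) (u : R -> R) (x : R) : R :=
  lim (u y @[y --> x^'-]).

Definition bv_reg (R : realType) (a b : R) : set (R -> R) :=
  [set u | bv `]a, b[ u /\
    forall x, x \in `]a, b[ ->
      Num.min (left_lim u x) (right_lim u x) <= u x
        <= Num.max (left_lim u x) (right_lim u x)].

Definition jump_set (R : realType) (a b : R) (u : R -> R) : set R :=
  [set x | (x \in `]a, b[) /\ left_lim u x <> right_lim u x].

Definition Gamma (R : realType) (x : R) : R :=
  \int[@lebesgue_measure R]_(t in `]0, +oo[) (t `^ (x - 1) * expR (- t)).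

Definition Kconst (R : realType) (p alpha : R) : R :=
  Gamma (p + 1) * Gamma (alpha^-1 + 1) / Gamma (p + alpha^-1 + 1).

(* The L^p norm on (a, b): the function is extended by 0 outside (a, b), which
   changes neither the integral nor the essential supremum of its modulus. *)
Definition Lp_norm (R : realType) (a b : R) (p : \bar R) (f : R -> R) : \bar R :=
  'N[@lebesgue_measure R]_p[EFin \o (f \_ `]a, b[)]%E.

Definition height (R : realType) (a b : R) (g : R -> R) : R :=
  left_lim g b - right_lim g a.

(* In [gamma_bound] and [lambda_bound] the second branch is the limit as
   r -> +oo of the first one, i.e. the case p = +oo; p = -oo does not occur.
   Since [0 `^ 0 = 1], a factor H `^ 0 is 1 also when H = 0. *)
Definition gamma_bound (R : realType) (p : \bar R) (alpha : R) : R :=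
  if p is r%:E then (1 + (r * alpha)^-1)^-1 else 1.

Definition lambda_bound (R : realType) (p : \bar R) (alpha gamma C H : R) : R :=
  if p is r%:E then
    2 `^ (((r - 1) * alpha + 1) / (r * alpha + 1))
    * Kconst r alpha `^ (- (gamma / r))
    * C `^ (gamma / (r * alpha))
    * H `^ (1 - gamma * (1 + (r * alpha)^-1))
  else 2 * H `^ (1 - gamma).

(* Extended-real valued, but finite on [bv `]a, b[]. *)
Definition TV_functional (R : realType) (a b lambda gamma : R) (p : \bar R)
    (g u : R -> R) : \bar R :=
  (pointwise_TV `]a, b[ u
   + lambda%:E * (Lp_norm a b p (fun x => (u x - g x)%R) `^ gamma))%E.

Definition is_minimizer (R : realType) (A : set (R -> R))
    (F : (R -> R) -> \bar R) (u : R -> R) : Prop :=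
  A u /\ forall v, A v -> (F u <= F v)%E.

(* Main.v *)
(* Let [H] be the height of [g] and suppose that [TV u = H - h] with
   [0 < h <= H]. The values of [u] lie in an interval of length at most [H - h],
   so [u] misses the range of [g] by [h1] near [a] and by [h2] near [b], with
   [h1 + h2 = h]. By the growth condition, [`|u - g|] is at least
   [h1 - C (x - a)^alpha] near [a] and [h2 - C (b - x)^alpha] near [b]. The p-th
   powers of these bounds integrate to [K C^(-1/alpha) h_i^(p + 1/alpha)], where
   [K] is the beta integral of [(1 - z^alpha)^p] over (0, 1), and by convexity
   their sum is smallest for [h1 = h2 = h / 2]. The condition on [lambda] says
   that the fidelity term then exceeds [h]. Hence a minimizer [u] has
   [TV u = H] and is at distance 0 from [g] in L^p, and it cannot differ from [g]
   at a point of continuity without increasing its variation. *)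

Require Import Defs.
From HB Require Import structures.
From mathcomp Require Import all_boot all_order all_algebra.
From mathcomp Require Import all_classical all_reals all_analysis.
From mathcomp Require Import measurable_realfun ess_sup_inf lra ring.

Set Implicit Arguments.
Unset Strict Implicit.
Unset Printing Implicit Defensive.

Import Order.TTheory GRing.Theory Num.Theory.
Import numFieldNormedType.Exports.

Local Open Scope classical_set_scope.
Local Open Scope ring_scope.

(** * Comparison and affine changes of variable for Lebesgue integrals *)

Section lebesgue_integral_complements.
Context {R : realType}.
Local Notation mu := (@lebesgue_measure R).
Local Open Scope ereal_scope.

(* Unlike [ge0_le_integral], [f2] need not be measurable: this avoids proving
   that functions of bounded variation are. *)
Lemma le_integralT d (T : measurableType d) (m : {measure set T -> \bar R})
    (f1 f2 : T -> \bar R) :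
  (forall x, 0 <= f1 x) -> (forall x, f1 x <= f2 x) ->
  \int[m]_x f1 x <= \int[m]_x f2 x.
Proof.
move=> f10 f12; rewrite !ge0_integralTE//; last first.
  by move=> x; exact: le_trans (f12 x).
apply: ereal_sup_le => _ [h hf <-]; exists h => // x.
exact: le_trans (f12 x).
Qed.

Definition affine (c d : R) : measurableTypeR R -> measurableTypeR R :=
  fun x => (c * x + d)%R.

Lemma measurable_affine (c d : R) : measurable_fun setT (affine c d).
Proof. by apply: measurable_funD => //; exact: measurable_funM. Qed.

(** By uniqueness of Lebesgue measure it suffices to test half-open intervals, whose preimages under
    [affine c d] have their length divided by [c]. The pushforward form yields the affine change of
    variables. *)
Lemma lebesgue_measure_affine (c d : R) (c0 : (0 < c)%R) A : measurable A ->
  mu A = pushforward (mscale (NngNum (ltW c0)) mu) (affine c d) A.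
Proof.
have maff := measurable_affine c d.
apply: lebesgue_measure_unique => //= X /ocitvP[->|[[a b]/= ab ->]].
  by rewrite /pushforward preimage_set0 !measure0.
rewrite /pushforward /mscale/=.
rewrite (_ : affine c d @^-1` _ = `](a - d) / c, (b - d) / c]%classic)%R;
    last first.
  by apply/seteqP; split => x /=; rewrite !in_itv/= /affine;
    rewrite ltr_pdivrMr// ler_pdivlMr// ltrBlDr lerBrDr mulrC.
rewrite !lebesgue_measure_itv/= !lte_fin ltr_pM2r ?invr_gt0// ltrD2r ab.
rewrite -!EFinD -EFinM; congr EFin.
by field; rewrite gt_eqF.
Qed.

Lemma ge0_integral_affine (c d : R) (f : R -> \bar R) : (0 < c)%R ->
  measurable_fun setT f -> (forall x, 0 <= f x) ->
  \int[mu]_x f (c * x + d)%R = c^-1%:E * \int[mu]_x f x.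
Proof.
move=> c0 mf f0; have maff := measurable_affine c d.
have -> : \int[mu]_x f x =
    \int[pushforward (mscale (NngNum (ltW c0)) mu) (affine c d)]_x f x.
  by apply: eq_measure_integral => //= A mA _; exact: lebesgue_measure_affine.
rewrite ge0_integral_pushforward// preimage_setT ge0_integral_mscale//=;
  last exact: measurableT_comp.
by rewrite muleA -EFinM mulVf ?gt_eqF// mul1e.
Qed.

Lemma ge0_integral_oppr (f : R -> \bar R) :
  measurable_fun setT f -> (forall x, 0 <= f x) ->
  \int[mu]_x f (- x)%R = \int[mu]_x f x.
Proof.
move=> mf f0.
transitivity (\int[pushforward mu (-%R : _ -> measurableTypeR R)]_x f x).
  by rewrite ge0_integral_pushforward.
by apply: eq_measure_integral => //= A mA _; exact: lebesgue_measureN.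
Qed.

End lebesgue_integral_complements.

(** * Gamma and beta integrals *)

(* The test [0 < x] is needed: [x `^ p = 1] for [x < 0]. *)
Definition pos_pow {R : realType} (p x : R) : R := if 0 < x then x `^ p else 0.

Section gamma_beta.
Context {R : realType}.
Local Notation mu := (@lebesgue_measure R).
Implicit Types (p al x w z h C : R).

Lemma pos_powE p x : 0 < x -> pos_pow p x = x `^ p.
Proof. by rewrite /pos_pow => ->. Qed.

Lemma pos_pow_le0 p x : x <= 0 -> pos_pow p x = 0.
Proof. by rewrite /pos_pow leNgt => /negbTE ->. Qed.

Lemma pos_pow_ge0 p x : 0 <= pos_pow p x.
Proof. by rewrite /pos_pow; case: ifP => // _; exact: powR_ge0. Qed.

Lemma pos_powM p c x : 0 < c -> pos_pow p (c * x) = c `^ p * pos_pow p x.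
Proof.
move=> c0; rewrite /pos_pow pmulr_rgt0//; case: ifPn => [x0|_].
  by rewrite powRM// ltW.
by rewrite mulr0.
Qed.

Lemma pos_powE_patch p : pos_pow p = (fun x => x `^ p) \_ `]0, +oo[.
Proof.
apply/funext => x; rewrite patchE /pos_pow mem_setE/= in_itv/= andbT.
by case: ifP.
Qed.

Lemma measurable_pos_pow p : measurable_fun setT (@pos_pow R p).
Proof.
rewrite pos_powE_patch; apply/(measurable_restrictT _ _).1 => //.
by apply: measurable_funTS; exact: measurable_powR.
Qed.

Local Open Scope ereal_scope.

(** Gamma at [p + 1], kept in the extended reals so that Tonelli applies before finiteness is
    known. *)
Definition egamma p : \bar R := \int[mu]_x (pos_pow p x * expR (- x))%:E.

(** For [0 < al], the beta integral of (1 - z^al)^p over (0, 1): [pos_pow 0 z] is the indicator of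
    [0 < z], and the other factor vanishes for z >= 1. *)
Definition ebeta p al : \bar R :=
  \int[mu]_z (pos_pow 0 z * pos_pow p (1 - z `^ al))%:E.

Let kernel p al (wz : R * R) : R :=
  (pos_pow 0 wz.2 * pos_pow p (wz.1 - wz.2 `^ al) * expR (- wz.1))%R.

Let measurable_kernel p al : measurable_fun setT (kernel p al).
Proof.
apply: measurable_funM; first apply: measurable_funM.
- exact: (measurableT_comp (measurable_pos_pow 0) (@measurable_snd _ _ _ _)).
- apply: (measurableT_comp (measurable_pos_pow p)).
  apply: measurable_funB; first exact: measurable_fst.
  exact: (measurableT_comp (measurable_powR al) (@measurable_snd _ _ _ _)).
- apply: (measurableT_comp (@measurable_expR R)).
  exact: (measurableT_comp (@oppr_measurable R _) (@measurable_fst _ _ _ _)).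
Qed.

Lemma measurable_egamma p :
  measurable_fun setT (fun x => pos_pow p x * expR (- x))%R.
Proof.
apply: measurable_funM; first exact: measurable_pos_pow.
exact: measurableT_comp.
Qed.

Lemma measurable_ebeta p al h C :
  measurable_fun setT (fun z => pos_pow 0 z * pos_pow p (h - C * z `^ al))%R.
Proof.
apply: measurable_funM; first exact: measurable_pos_pow.
apply: measurableT_comp; first exact: measurable_pos_pow.
by apply: measurable_funB => //; apply: measurable_funM.
Qed.

Lemma ebeta_ge0 p al : 0 <= ebeta p al.
Proof.
by apply: integral_ge0 => z _; rewrite lee_fin mulr_ge0// pos_pow_ge0.
Qed.

Lemma egamma_ge0 p : 0 <= egamma p.
Proof.
apply: integral_ge0 => z _.
by rewrite lee_fin mulr_ge0 ?pos_pow_ge0 ?expR_ge0.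
Qed.

Lemma ebeta_scale p al h C : (0 < al)%R -> (0 < h)%R -> (0 < C)%R ->
  \int[mu]_z (pos_pow 0 z * pos_pow p (h - C * z `^ al))%:E =
  (h `^ (p + al^-1) * C `^ (- al^-1))%:E * ebeta p al.
Proof.
(* This scale makes C z^al = h (c z)^al, so that h factors out of the difference. *)
move=> al0 h0 C0; pose c := ((C / h) `^ al^-1)%R.
have Ch0 : (0 < C / h)%R by rewrite divr_gt0.
have c0 : (0 < c)%R by rewrite powR_gt0.
pose f z := (pos_pow 0 z * pos_pow p (1 - 1 * z `^ al))%:E.
have mf : measurable_fun setT f.
  by apply/measurable_EFinP; exact: (@measurable_ebeta p al 1 1).
have f0 z : 0 <= f z by rewrite lee_fin mulr_ge0// pos_pow_ge0.
transitivity (\int[mu]_z ((h `^ p)%:E * f (c * z + 0)%R)).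
  apply: eq_integral => z _; rewrite /f -EFinM; congr EFin.
  have [z0|z0] := leP z 0%R.
    have cz0 : (c * z + 0 <= 0)%R by rewrite addr0 pmulr_rle0.
    rewrite (@pos_pow_le0 0 _ z0) (@pos_pow_le0 0 _ cz0).
    by rewrite [LHS]mul0r [X in (_ * X)%R]mul0r mulr0.
  rewrite addr0 (@pos_powM 0 c z c0) powRr0 mul1r mul1r powRM ?ltW// -powRrM.
  rewrite mulVf ?gt_eqF// powRr1 ?ltW// mulrCA; congr (_ * _)%R.
  rewrite -(@pos_powM p h)// mulrBr mulr1; congr (pos_pow p (_ - _)).
  by field; rewrite gt_eqF.
have mfc : measurable_fun setT (fun z => f (c * z + 0)%R).
  exact: (measurableT_comp mf (measurable_affine c 0)).
have hp0 : 0 <= (h `^ p)%:E by rewrite lee_fin powR_ge0.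
rewrite (@ge0_integralZl _ _ _ mu _ measurableT _ mfc _ (fun x _ => f0 _) hp0).
rewrite (ge0_integral_affine 0 c0 mf f0) muleA -EFinM.
congr (_%:E * _); last first.
  by rewrite /ebeta; apply: eq_integral => z _; rewrite /f mul1r.
rewrite -powRN powRM ?invr_ge0 ?ltW// -(powR_inv1 (ltW h0)) -powRrM.
rewrite [in RHS]powRD; last by rewrite (gt_eqF h0) implybT.
by rewrite mulN1r opprK -mulrA; congr (_ * _)%R; rewrite mulrC.
Qed.

(* Tonelli for [kernel p al (w, z)], translating by [z `^ al] in the variable [w]
   and scaling in the variable [z]. For [p = 0] this identifies the integral on
   the left-hand side with [egamma al^-1], without a change of variables. *)
Lemma egammaM_int_expR p al : (0 < al)%R ->
  egamma p * \int[mu]_z (pos_pow 0 z * expR (- z `^ al))%:E =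
  egamma (p + al^-1) * ebeta p al.
Proof.
move=> al0.
have mexp : measurable_fun setT
    (fun z => pos_pow 0 z * expR (- z `^ al) : R)%R.
  apply: measurable_funM; first exact: measurable_pos_pow.
  apply: (measurableT_comp (@measurable_expR R)).
  apply: (measurableT_comp (@oppr_measurable R _)).
  exact: measurable_powR.
have k0 wz : 0 <= (EFin \o kernel p al) wz.
  by rewrite lee_fin !mulr_ge0 ?pos_pow_ge0 ?expR_ge0.
have mk : measurable_fun setT (EFin \o kernel p al).
  by apply/measurable_EFinP; exact: measurable_kernel.
have := @fubini_tonelli _ _ _ _ R mu mu (EFin \o kernel p al) mk k0.
(* Inner integral in z: for w > 0, scaling with h = w and C = 1 produces w^(p + 1/al); for w <= 0
   the kernel vanishes. *)
rewrite [X in X = _ -> _](_ : _ = egamma (p + al^-1) * ebeta p al); last first.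
  rewrite /egamma -ge0_integralZr ?ebeta_ge0//; last 2 first.
  - by apply/measurable_EFinP; exact: measurable_egamma.
  - by move=> w _; rewrite lee_fin mulr_ge0 ?pos_pow_ge0 ?expR_ge0.
  apply: eq_integral => w _.
  have [w0|w0] := leP w 0%R.
    rewrite pos_pow_le0// mul0r mul0e; apply: integral0_eq => z _.
    rewrite /= /kernel/= (@pos_pow_le0 p) ?mulr0 ?mul0r//.
    by rewrite subr_le0 (le_trans w0)// powR_ge0.
  rewrite pos_powE// mulrC EFinM -muleA.
  have := @ebeta_scale p al w 1 al0 w0 ltr01; rewrite powR1 mulr1 => <-.
  have mb : measurable_fun setT
      (fun z => (pos_pow 0 z * pos_pow p (w - 1 * z `^ al))%:E).
    by apply/measurable_EFinP; exact: (@measurable_ebeta p al w 1).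
  rewrite -(ge0_integralZl mu measurableT mb); last 2 first.
  - by move=> z _; rewrite lee_fin mulr_ge0// pos_pow_ge0.
  - by rewrite lee_fin expR_ge0.
  by apply: eq_integral => z _; rewrite -EFinM/= /kernel/= mul1r mulrC.
(* Inner integral in w: the translation by z^al turns it into exp(-z^al) times [egamma p]. *)
move=> ->; rewrite muleC -ge0_integralZr ?egamma_ge0//; last 2 first.
- exact/measurable_EFinP.
- by move=> z _; rewrite lee_fin mulr_ge0 ?pos_pow_ge0 ?expR_ge0.
apply: eq_integral => z _.
have := @ge0_integral_affine R 1 (- z `^ al)
  (fun x => (pos_pow p x * expR (- x))%:E) ltr01.
rewrite invr1 mul1e -/(egamma p) => <-; last 2 first.
- by apply/measurable_EFinP; exact: measurable_egamma.
- by move=> x; rewrite lee_fin mulr_ge0 ?pos_pow_ge0 ?expR_ge0.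
have mg : measurable_fun setT (fun w =>
    (pos_pow p (1 * w + - z `^ al) * expR (- (1 * w + - z `^ al)))%:E).
  apply/measurable_EFinP.
  exact: (measurableT_comp (measurable_egamma p) (measurable_affine _ _)).
rewrite -(ge0_integralZl mu measurableT mg); last 2 first.
- by move=> w _; rewrite lee_fin mulr_ge0 ?pos_pow_ge0 ?expR_ge0.
- by rewrite lee_fin mulr_ge0 ?pos_pow_ge0 ?expR_ge0.
apply: eq_integral => w _; rewrite -EFinM/= /kernel/=; congr EFin.
rewrite mul1r -!mulrA; congr (_ * _)%R; rewrite mulrCA; congr (_ * _)%R.
by rewrite -expRD; congr expR; ring.
Qed.

End gamma_beta.

Section gamma_function.
Context {R : realType}.
Local Notation mu := (@lebesgue_measure R).
Implicit Types (p al x w z h C : R).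
Local Open Scope ereal_scope.

Lemma egamma0 : egamma (0%R : R) = 1.
Proof.
rewrite -(@integral_exponential_pdf R 1 ltr01) /egamma.
have mexp : measurable_fun (`]0%R, +oo[%classic : set R)
    (fun x : R => (expR (- x))%:E).
  by apply/measurable_EFinP/measurable_funTS; exact: measurableT_comp.
transitivity (\int[mu]_(x in `]0%R, +oo[) (expR (- x))%:E).
  rewrite [RHS]integral_mkcond; apply: eq_integral => x _.
  rewrite patchE mem_setE/= in_itv/= andbT.
  case: ifPn => [x0|]; first by rewrite pos_powE// powRr0 mul1r.
  by rewrite -leNgt => x0; rewrite pos_pow_le0// mul0r.
rewrite integral_itv_obnd_cbnd// integral_mkcond; apply: eq_integral => x _.
rewrite /exponential_pdf !patchE; case: ifP => // _.
by rewrite mul1r mulN1r.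
Qed.

(** For p = 0 the integrand is the indicator of (0, 1). *)
Lemma ebeta0 al : (0 < al)%R -> ebeta 0 al = 1.
Proof.
move=> al0; have a1 : (1 `^ al = 1 :> R)%R by rewrite powR1.
transitivity (mu `]0%R, 1%R[).
  rewrite -[RHS]mul1e -integral_cst// [RHS]integral_mkcond.
  apply: eq_integral => z _; rewrite patchE mem_setE/= in_itv/=.
  have [z0|z0] := leP z 0%R; first by rewrite pos_pow_le0 ?mul0r//= ltNge z0.
  rewrite (pos_powE _ z0) powRr0 mul1r /=; case: ltP => z1.
    rewrite pos_powE ?powRr0// subr_gt0.
    by rewrite -[ltRHS]a1 gt0_ltr_powR// nnegrE ?ltW.
  rewrite pos_pow_le0// subr_le0.
  by rewrite -[leLHS]a1 ge0_ler_powR// ?nnegrE// ?ltW.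
by rewrite lebesgue_measure_itv/= lte_fin ltr01 -EFinB subr0.
Qed.

Lemma egamma_lty p : (0 <= p)%R -> egamma p < +oo.
Proof.
rewrite le_eqVlt => /predU1P[<-|p0]; first by rewrite egamma0 ltry.
(* From ln y <= y - 1 at y = x / (2p) follows x^p <= M exp(x / 2), so M exp(-x / 2) dominates the
   integrand. *)
pose M := expR (p * ln (2 * p) - p).
pose f x := (pos_pow 0 x * expR (- x))%:E.
have mf : measurable_fun setT f.
  by apply/measurable_EFinP; exact: measurable_egamma.
have f0 x : 0 <= f x by rewrite lee_fin mulr_ge0 ?pos_pow_ge0 ?expR_ge0.
have half0 : (0 < 2^-1 :> R)%R by rewrite invr_gt0.
apply: (@le_lt_trans _ _ (\int[mu]_x (M%:E * f (2^-1 * x + 0)%R))).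
  apply: le_integralT => x.
    by rewrite lee_fin mulr_ge0 ?pos_pow_ge0 ?expR_ge0.
  rewrite -EFinM lee_fin addr0 (@pos_powM _ 0 _ _ half0) powRr0 mul1r.
  have [x0|x0] := leP x 0%R; first by rewrite !pos_pow_le0// !mul0r mulr0.
  rewrite !pos_powE// powRr0 mul1r /powR gt_eqF// -!expRD ler_expR.
  have p2 : (0 < 2 * p)%R by rewrite mulr_gt0.
  have := @le_ln1Dx R (x / (2 * p) - 1).
  rewrite addrCA subrr addr0 lnM ?posrE ?invr_gt0// lnV ?posrE//.
  have xp0 : (0 < x / (2 * p))%R by rewrite divr_gt0.
  move=> /(_ ltac:(lra)); rewrite -(ler_pM2l p0) => le1.
  have e1 : (p * (x / (2 * p) - 1) = 2^-1 * x - p)%R.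
    by field; rewrite gt_eqF.
  rewrite e1 in le1; lra.
have mfc : measurable_fun setT (fun x => f (2^-1 * x + 0)%R).
  exact: (measurableT_comp mf (measurable_affine 2^-1 0)).
have M0 : 0 <= M%:E by rewrite lee_fin expR_ge0.
rewrite (@ge0_integralZl _ _ _ mu _ measurableT _ mfc _ (fun x _ => f0 _) M0).
rewrite (ge0_integral_affine 0 half0 mf f0).
by rewrite -/(egamma 0) egamma0 mule1 -EFinM ltry.
Qed.

Lemma egamma_gt0 p : (0 <= p)%R -> 0 < egamma p.
Proof.
move=> p0.
apply: (@lt_le_trans _ _ (\int[mu]_(x in `]1%R, 2%R[) (expR (- 2))%:E)).
  rewrite integral_cst//= lebesgue_measure_itv/= lte_fin ltr1n -EFinB -EFinM.
  by rewrite lte_fin mulr_gt0 ?expR_gt0// subr_gt0 ltr1n.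
rewrite integral_mkcond; apply: le_integralT => x; rewrite patchE.
  by case: ifP => // _; rewrite lee_fin expR_ge0.
rewrite mem_setE/= in_itv/=; case: ifPn => [/andP[x1 x2]|_]; last first.
  by rewrite lee_fin mulr_ge0 ?pos_pow_ge0 ?expR_ge0.
rewrite lee_fin pos_powE ?(lt_trans ltr01)// -[leLHS]mul1r ler_pM ?expR_ge0//.
  by rewrite -(powRr0 x) ler_powR// ltW.
by rewrite ler_expR lerN2 ltW.
Qed.

Lemma egammaE p : (0 < p)%R -> egamma p = (Gamma (p + 1))%:E.
Proof.
move=> p0; rewrite /Gamma /Rintegral.
rewrite [X in fine X](_ : _ = egamma p).
  rewrite fineK// ge0_fin_numE ?egamma_lty ?egamma_ge0// ltW//.
rewrite integral_mkcond; apply: eq_integral => x _; rewrite patchE.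
rewrite mem_setE/= in_itv/= andbT addrK /pos_pow.
by case: ifP => //; rewrite mul0r.
Qed.

Lemma Gamma_gt0 p : (0 < p)%R -> (0 < Gamma (p + 1))%R.
Proof. by move=> p0; rewrite -lte_fin -egammaE// egamma_gt0// ltW. Qed.

Lemma Kconst_gt0 p al : (0 < p)%R -> (0 < al)%R -> (0 < Kconst p al)%R.
Proof.
move=> p0 al0; have al0' : (0 < al^-1)%R by rewrite invr_gt0.
by rewrite /Kconst divr_gt0 ?mulr_gt0 ?Gamma_gt0// addr_gt0.
Qed.

(** The instance p = 0 of [egammaM_int_expR] evaluates the integral of exp(-z^al) as a Gamma value;
    inserting it into the instance for p leaves [ebeta] as the quotient defining [Kconst]. *)
Lemma ebetaE p al : (0 < p)%R -> (0 < al)%R -> ebeta p al = (Kconst p al)%:E.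
Proof.
move=> p0 al0; have al0' : (0 < al^-1)%R by rewrite invr_gt0.
have := @egammaM_int_expR R 0 al al0.
rewrite egamma0 mul1e ebeta0// mule1 add0r => E.
have := @egammaM_int_expR R p al al0.
have pal0 : (0 < p + al^-1)%R by rewrite addr_gt0.
rewrite E !egammaE// -EFinM; have := @ebeta_ge0 R p al.
have G0 := Gamma_gt0 pal0.
(* An infinite [ebeta] times a positive Gamma value could not equal the finite left-hand side. *)
case: ebeta => [r _|_|//]; last by rewrite gt0_muley ?lte_fin.
rewrite -EFinM => -[H]; congr EFin; rewrite /Kconst H mulrC mulKf//.
by rewrite gt_eqF.
Qed.

End gamma_function.

(** * One-sided limits and total variation *)

Section monotone_limits.
Context {R : realType}.
Implicit Types (f : R -> R) (a b x y c e : R).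

(** Monotone convergence makes the [lim] in [left_lim] a genuine limit, hence the supremum. The free
    bound [c] allows the approximating point to be placed beyond points already chosen. *)
Lemma left_lim_sup f a x : a < x ->
  {in `]a, x[ &, {homo f : y z / y <= z}} -> has_ubound (f @` `]a, x[) ->
  (forall y, y \in `]a, x[ -> f y <= left_lim f x) /\
  (forall c e, c < x -> 0 < e ->
     exists y, [/\ y \in `]a, x[, c < y & left_lim f x - e < f y]).
Proof.
move=> ax ndf [M fM].
have cf : cvg (f y @[y --> x^'-]).
  apply: nondecreasing_at_left_is_cvgr.
    near=> c => y z yc zc; apply: ndf.
      by apply: subset_itvr yc; rewrite bnd_simp ltW.
    by apply: subset_itvr zc; rewrite bnd_simp ltW.
  near=> c; exists M => _ [y yc <-]; apply: fM; exists y => //.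
  by apply: subset_itvr yc; rewrite bnd_simp ltW.
split=> [y|c e cx e0].
  rewrite in_itv/= => /andP[ay yx]; apply: limr_ge => //; near=> z.
  apply: ndf; rewrite ?in_itv/= ?ay//.
    by apply/andP; split.
  exact: ltW.
have /cvgrPdist_lt/(_ e e0) : f y @[y --> x^'-] --> left_lim f x by [].
move=> fe; near x^'- => y; exists y; split => //.
  by rewrite in_itv/=; apply/andP; split.
have : `|left_lim f x - f y| < e by near: y.
by move/ltr_normlW; rewrite ltrBlDl ltrBlDr addrC.
Unshelve. all: by end_near. Qed.

Lemma right_lim_inf f b x : x < b ->
  {in `]x, b[ &, {homo f : y z / y <= z}} -> has_lbound (f @` `]x, b[) ->
  (forall y, y \in `]x, b[ -> right_lim f x <= f y) /\
  (forall c e, x < c -> 0 < e ->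
     exists y, [/\ y \in `]x, b[, y < c & f y < right_lim f x + e]).
Proof.
move=> xb ndf [M fM].
have cf : cvg (f y @[y --> x^'+]).
  apply: nondecreasing_at_right_is_cvgr.
    near=> c => y z yc zc; apply: ndf.
      by apply: subset_itvl yc; rewrite bnd_simp ltW.
    by apply: subset_itvl zc; rewrite bnd_simp ltW.
  near=> c; exists M => _ [y yc <-]; apply: fM; exists y => //.
  by apply: subset_itvl yc; rewrite bnd_simp ltW.
split=> [y|c e cx e0].
  rewrite in_itv/= => /andP[xy yb]; apply: limr_le => //; near=> z.
  apply: ndf; rewrite ?in_itv/= ?xy ?yb//.
    by apply/andP; split.
  exact: ltW.
have /cvgrPdist_lt/(_ e e0) : f y @[y --> x^'+] --> right_lim f x by [].
move=> fe; near x^'+ => y; exists y; split => //.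
  by rewrite in_itv/=; apply/andP; split.
have : `|right_lim f x - f y| < e by near: y.
by rewrite distrC => /ltr_normlW; rewrite ltrBlDl.
Unshelve. all: by end_near. Qed.

End monotone_limits.

Section pointwise_total_variation.
Context {R : realType}.
Implicit Types (I : interval R) (u : R -> R).

Lemma pointwise_TV_ge0 I u x : x \in I -> (0 <= pointwise_TV I u)%E.
Proof.
move=> xI; apply: ereal_sup_ubound; exists 0, (fun=> x).
by split => //; rewrite big_ord0.
Qed.

Lemma pointwise_TV_path I u x s : all (mem I) (x :: s) ->
  sorted <=%R (x :: s) ->
  ((\sum_(i < size s) `|u (nth x (x :: s) i.+1) - u (nth x (x :: s) i)|)%:E
    <= pointwise_TV I u)%E.
Proof.
move=> /all_nthP xI /sortedP xs; apply: ereal_sup_ubound.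
exists (size s), (nth x (x :: s)); split => // [i si|i si].
  exact: (xI x).
exact: (xs x).
Qed.

Lemma dist_le_pointwise_TV I u x y : x \in I -> y \in I ->
  (`|u x - u y|%:E <= pointwise_TV I u)%E.
Proof.
move=> xI yI; wlog xy : x y xI yI / x <= y.
  move=> h; have [xy|/ltW yx] := leP x y; first exact: h.
  by rewrite distrC; exact: h.
have := @pointwise_TV_path I u x [:: y].
by rewrite /= xI yI xy big_ord1 /= distrC; exact.
Qed.

Lemma pointwise_TV_monotone I u (A B : R) : {in I &, {homo u : x y / x <= y}} ->
  {in I, forall x, A <= u x <= B} ->
  (pointwise_TV I u <= (B - A)%:E)%E.
Proof.
move=> ndu uAB; apply: ge_ereal_sup => _ [n [x [xI xs ->]]].
rewrite lee_fin.
have -> : \sum_(i < n) `|u (x i.+1) - u (x i)| =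
          \sum_(i < n) (u (x i.+1) - u (x i)).
  apply: eq_bigr => i _; rewrite ger0_norm// subr_ge0; apply: ndu.
  - exact/xI/ltnW.
  - exact: xI.
  - exact: xs.
rewrite -(big_mkord xpredT (fun i => u (x i.+1) - u (x i))) telescope_sumr//.
have /andP[_ ?] := uAB _ (xI _ (leqnn n)).
have /andP[? _] := uAB _ (xI _ (leq0n n)).
by rewrite lerB.
Qed.

End pointwise_total_variation.

(** * Lower bounds for the L^p norm *)

Section norm_lower_bounds.
Context {R : realType}.
Local Notation mu := (@lebesgue_measure R).
Implicit Types (a b p al h C c : R) (f : R -> R).

Lemma Lp_norm_powR a b p f : p != 0 ->
  (Lp_norm a b p%:E f `^ p =
   \int[mu]_x (`|(f \_ `]a, b[) x| `^ p)%:E)%E.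
Proof.
by move=> p0; rewrite /Lp_norm poweR_Lnorm.
Qed.

(** If the essential supremum were below [c], the whole interval would lie in an exceptional null
    set, although its length is positive. *)
Lemma Lp_norm_pinfty_ge a b f y1 y2 c : y1 < y2 -> 0 <= c ->
  (forall x, x \in `]y1, y2[ -> (x \in `]a, b[) /\ c <= `|f x|) ->
  (c%:E <= Lp_norm a b +oo f)%E.
Proof.
move=> y12 c0 cf.
(* The norm for p = +oo is an essential supremum only on a space of positive measure. *)
have muT : (0 < mu [set: R])%E.
  by rewrite -set_itvNyy lebesgue_measure_itv/= addye// ltry.
rewrite /Lp_norm Lnorm.unlock muT.
rewrite leNgt; apply/negP => fc.
have [N [mN N0 sN]] := ess_sup_ge mu (abse \o (EFin \o f \_ `]a, b[)).
have yN : `]y1, y2[%classic `<=` N.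
  move=> x xy; apply: sN => /= fx; have [xab cfx] := cf x xy.
  have := le_lt_trans fx fc.
  by rewrite patchE mem_setE xab lte_fin ltNge cfx.
have : (mu `]y1, y2[%classic <= mu N)%E by apply: le_measure; rewrite ?inE.
rewrite [mu N]N0 lebesgue_measure_itv/= lte_fin y12 -EFinB lee_fin.
by rewrite leNgt subr_gt0 y12.
Qed.

Lemma Lp_norm_gt0 a b (p : \bar R) f y1 y2 c : (1%:E <= p)%E ->
  y1 < y2 -> 0 < c ->
  (forall x, x \in `]y1, y2[ -> (x \in `]a, b[) /\ c <= `|f x|) ->
  (0 < Lp_norm a b p f)%E.
Proof.
case: p => [p|_|//]; last first.
  move=> y12 c0 cf; apply: (@lt_le_trans _ _ c%:E); first by rewrite lte_fin.
  exact: Lp_norm_pinfty_ge y12 (ltW c0) cf.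
rewrite lee_fin => p1 y12 c0 cf; have p0 : 0 < p := lt_le_trans ltr01 p1.
rewrite lt0e Lnorm_ge0 andbT; apply/eqP => N0.
have := Lp_norm_powR a b f (lt0r_neq0 p0).
rewrite N0 poweR0r ?gt_eqF// => /esym I0.
have : (\int[mu]_(x in `]y1, y2[) (c `^ p)%:E <= 0)%E.
  rewrite -I0 integral_mkcond; apply: le_integralT => x; rewrite patchE.
    by case: ifP => // _; rewrite lee_fin powR_ge0.
  rewrite mem_setE; case: ifPn => [xy|_]; last by rewrite lee_fin powR_ge0.
  have [xab cfx] := cf x xy; rewrite lee_fin patchE mem_setE xab.
  by rewrite ge0_ler_powR ?nnegrE// ltW.
rewrite integral_cst//= lebesgue_measure_itv/= lte_fin y12.
rewrite -EFinB -EFinM lee_fin.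
by rewrite leNgt mulr_gt0 ?powR_gt0 ?subr_gt0.
Qed.

(** Convexity of t^r at the midpoint of x and y, multiplied by 2. *)
Lemma powR_half_sum (r x y : R) : 1 <= r -> 0 <= x -> 0 <= y ->
  2 `^ (1 - r) * (x + y) `^ r <= x `^ r + y `^ r.
Proof.
move=> r1 x0 y0; have half0 : (0 : R) <= 2^-1 by rewrite invr_ge0.
have half1 : 2^-1 <= (1 : R) by rewrite invf_le1// ler1n.
have := @convex_powR R r r1 (Itv01 half0 half1) x y.
rewrite !inE/= !in_itv/= !andbT => /(_ x0 y0).
rewrite [X in X `^ _ <= _]convRE convRE/= /unstable.onem.
have -> : 1 - 2^-1 = 2^-1 :> R by lra.
rewrite -!mulrDr powRM ?addr_ge0// -powR_inv1// -powRrM mulN1r => xy.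
rewrite powRD; last by rewrite pnatr_eq0 implybT.
rewrite powRr1// -mulrA -ler_pdivlMl// -powR_inv1//.
Qed.

(** Adds the case h = 0, where both sides vanish; it occurs when the whole gap lies at one end. *)
Lemma ebeta_scale_ge0 p al h C : 0 < p -> 0 < al -> 0 <= h -> 0 < C ->
  (\int[mu]_z (pos_pow 0 z * pos_pow p (h - C * z `^ al))%:E =
  (Kconst p al * C `^ (- al^-1) * h `^ (p + al^-1))%:E)%E.
Proof.
move=> p0 al0; rewrite le_eqVlt => /predU1P[<-|h0] C0; last first.
  by rewrite ebeta_scale// ebetaE// -EFinM; congr EFin; ring.
rewrite powR0 ?mulr0; last by rewrite gt_eqF// addr_gt0// invr_gt0.
apply: integral0_eq => z _; rewrite (@pos_pow_le0 _ p) ?mulr0// sub0r.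
by rewrite oppr_le0 mulr_ge0 ?powR_ge0// ltW.
Qed.

Lemma ebeta_scale_left a p al h C : 0 < p -> 0 < al -> 0 <= h -> 0 < C ->
  (\int[mu]_x (pos_pow 0 (x - a) * pos_pow p (h - C * (x - a) `^ al))%:E =
  (Kconst p al * C `^ (- al^-1) * h `^ (p + al^-1))%:E)%E.
Proof.
move=> p0 al0 h0 C0; rewrite -(ebeta_scale_ge0 p0 al0 h0 C0).
pose f z := (pos_pow 0 z * pos_pow p (h - C * z `^ al))%:E.
have mf : measurable_fun setT f.
  by apply/measurable_EFinP; exact: measurable_ebeta.
have f0 z : (0 <= f z)%E by rewrite lee_fin mulr_ge0 ?pos_pow_ge0.
transitivity (\int[mu]_x f (1 * x + - a)%R)%E.
  by apply: eq_integral => x _; rewrite mul1r.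
by rewrite [LHS](ge0_integral_affine (- a) ltr01 mf f0) invr1 [LHS]mul1e.
Qed.

(** The reflection x -> -x turns the right end [b] into the left end [- b]. *)
Lemma ebeta_scale_right b p al h C : 0 < p -> 0 < al -> 0 <= h -> 0 < C ->
  (\int[mu]_x (pos_pow 0 (b - x) * pos_pow p (h - C * (b - x) `^ al))%:E =
  (Kconst p al * C `^ (- al^-1) * h `^ (p + al^-1))%:E)%E.
Proof.
move=> p0 al0 h0 C0; rewrite -(ebeta_scale_left (- b) p0 al0 h0 C0).
pose f x := (pos_pow 0 (x - - b) * pos_pow p (h - C * (x - - b) `^ al))%:E.
have mf : measurable_fun setT f.
  apply/measurable_EFinP.
  apply: (measurableT_comp (@measurable_ebeta R p al h C)).
  exact: measurable_funB.
have f0 z : (0 <= f z)%E by rewrite lee_fin mulr_ge0 ?pos_pow_ge0.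
rewrite -[RHS](ge0_integral_oppr mf f0).
by apply: eq_integral => x _; rewrite /f opprK [- x + b]addrC.
Qed.

End norm_lower_bounds.

(** * Numerical consequences of the bounds on gamma and lambda, and a pointwise estimate *)

Section gap_estimates.
Context {R : realType}.
Implicit Types (p al gamma lambda C H K h x y : R).

(** The base of the power is the lower bound for the p-th power of the L^p distance at variation
    deficit [h]; the claim is that the fidelity term outweighs the deficit. The powers of K and C
    cancel those in [lambda_bound]. *)
Lemma lambda_bound_gap p al gamma lambda C H h : 1 <= p -> 0 < al ->
  0 < gamma -> 0 < C -> 0 < h -> h <= H -> gamma <= gamma_bound p%:E al ->
  lambda_bound p%:E al gamma C H < lambda ->
  h < lambda * (Kconst p al * C `^ (- al^-1) *
    (2 `^ (1 - (p + al^-1)) * h `^ (p + al^-1))) `^ (gamma / p).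
Proof.
rewrite /gamma_bound /lambda_bound => p1 al0 ga0 C0 h0 hH gale.
have p0 : 0 < p := lt_le_trans ltr01 p1.
have H0 : 0 < H := lt_le_trans h0 hH.
have pal0 : 0 < p * al by rewrite mulr_gt0.
have K0 : 0 < Kconst p al by exact: Kconst_gt0.
move: (Kconst p al) K0 => K K0.
set e := ((p - 1) * al + 1) / (p * al + 1).
pose s := gamma / p; pose t := gamma * (1 + (p * al)^-1).
pose r := p + al^-1.
rewrite -/s -/t -/r => lam.
have s0 : 0 <= s by rewrite divr_ge0 ?ltW.
have rs : r * s = t by rewrite /r /s /t; field; rewrite !gt_eqF.
have t1 : t <= 1.
  by rewrite /t -ler_pdivlMr ?div1r// addr_gt0// invr_gt0.
(* The total exponent of 2; it vanishes exactly at the critical gamma and is non-negative below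
   it. *)
have es : 0 <= e + (1 - r) * s.
  have -> : e + (1 - r) * s = ((p - 1) * al + 1) *
      ((1 + (p * al)^-1)^-1 - gamma) / (p * al).
    rewrite /e /r /s; field; rewrite !gt_eqF ?addr_gt0//.
  rewrite divr_ge0 ?(ltW pal0)// mulr_ge0 ?subr_ge0// addr_ge0//.
  by rewrite mulr_ge0 ?subr_ge0// ltW.
have C0' : 0 < C `^ (- al^-1) by rewrite powR_gt0.
have two0 : 0 < 2 `^ (1 - r) :> R by rewrite powR_gt0.
have hr0 : 0 < h `^ r by rewrite powR_gt0.
rewrite !powRM ?mulr_ge0 ?ltW// -!powRrM rs.
apply: (@le_lt_trans _ _ (2 `^ e * K `^ (- s) * C `^ (gamma / (p * al)) *
  H `^ (1 - t) * (K `^ s * C `^ (- al^-1 * s) * (2 `^ ((1 - r) * s) * h `^ t)))).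
  have -> : 2 `^ e * K `^ (- s) * C `^ (gamma / (p * al)) * H `^ (1 - t) *
      (K `^ s * C `^ (- al^-1 * s) * (2 `^ ((1 - r) * s) * h `^ t)) =
    (2 `^ e * 2 `^ ((1 - r) * s)) * (K `^ (- s) * K `^ s) *
    (C `^ (gamma / (p * al)) * C `^ (- al^-1 * s)) * (H `^ (1 - t) * h `^ t).
    by ring.
  rewrite -!powRD; last 3 first.
  - by rewrite (gt_eqF C0) implybT.
  - by rewrite (gt_eqF K0) implybT.
  - by rewrite pnatr_eq0 implybT.
  have -> : gamma / (p * al) + - al^-1 * s = 0.
    by rewrite /s; field; rewrite !gt_eqF.
  rewrite addNr !powRr0 !mulr1.
  (* Since t <= 1 and h <= H, the factor h^(1 - t) is at most H^(1 - t). *)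
  have h1 : h = h `^ (1 - t) * h `^ t.
    by rewrite -powRD ?subrK ?powRr1 ?ltW// (gt_eqF h0) implybT.
  rewrite [leLHS]h1 -[leLHS]mul1r ler_pM ?mulr_ge0 ?powR_ge0//.
    by rewrite -[leLHS](powRr0 2) ler_powR// ler1n.
  by rewrite ler_wpM2r ?powR_ge0// ge0_ler_powR ?nnegrE ?subr_ge0
    ?(ltW h0) ?(ltW H0).
by rewrite ltr_pM2r// !mulr_gt0 ?powR_gt0.
Qed.

(** Here [h / 2] is the uniform distance forced at one of the two ends by a deficit [h]. *)
Lemma lambda_bound_gap_pinfty al gamma lambda C H h :
  0 < gamma -> 0 < h -> h <= H -> gamma <= gamma_bound +oo al ->
  lambda_bound +oo al gamma C H < lambda ->
  h < lambda * (h / 2) `^ gamma.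
Proof.
rewrite /gamma_bound /lambda_bound => ga0 h0 hH gale lam.
have H0 : 0 < H := lt_le_trans h0 hH.
apply: (@le_lt_trans _ _ (2 * H `^ (1 - gamma) * (h / 2) `^ gamma)); last first.
  by rewrite ltr_pM2r// powR_gt0// divr_gt0.
have h1 : h = h `^ (1 - gamma) * h `^ gamma.
  by rewrite -powRD ?subrK ?powRr1 ?ltW// (gt_eqF h0) implybT.
rewrite powRM ?(ltW h0) ?invr_ge0// -powR_inv1// -powRrM mulN1r.
have -> : 2 * H `^ (1 - gamma) * (h `^ gamma * 2 `^ (- gamma)) =
  (2 `^ 1 * 2 `^ (- gamma)) * (H `^ (1 - gamma) * h `^ gamma).
  by rewrite powRr1//; ring.
rewrite -powRD; last by rewrite pnatr_eq0 implybT.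
rewrite [leLHS]h1 -[leLHS]mul1r.
rewrite ler_pM ?mulr_ge0 ?powR_ge0//.
  by rewrite -[leLHS](powRr0 2) ler_powR ?ler1n// subr_ge0.
by rewrite ler_wpM2r ?powR_ge0// ge0_ler_powR ?nnegrE ?subr_ge0
    ?(ltW h0) ?(ltW H0).
Qed.

(** Read v as u(x), w as g(x), and Ca, Cb as the growth bounds at x. The first summand is positive
    only if w < m, the second only if w > M, so at most one contributes, and it is controlled by the
    distance from w to [m, M]. *)
Lemma pos_pow_dist_le p v w m M Ca Cb A B h1 h2 : 0 < p -> m <= M ->
  m <= v <= M -> w - A <= Ca -> B - w <= Cb -> 0 <= Ca -> 0 <= Cb ->
  h1 <= Num.max 0 (m - A) -> h2 <= Num.max 0 (B - M) ->
  pos_pow p (h1 - Ca) + pos_pow p (h2 - Cb) <= `|v - w| `^ p.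
Proof.
move=> p0 mM /andP[mv vM] wA Bw Ca0 Cb0; rewrite !le_max => h1m h2M.
have h1P : 0 < h1 - Ca -> h1 - Ca <= m - w.
  by case/orP: h1m => ? ?; lra.
have h2P : 0 < h2 - Cb -> h2 - Cb <= w - M.
  by case/orP: h2M => ? ?; lra.
have pos_pow_dist z : 0 < z -> z <= `|v - w| -> pos_pow p z <= `|v - w| `^ p.
  by move=> z0 zv; rewrite pos_powE// ge0_ler_powR ?nnegrE// ltW.
have [h1C|/[dup] h1C /h1P h1w] := leP (h1 - Ca) 0;
  have [h2C|/[dup] h2C /h2P h2w] := leP (h2 - Cb) 0.
- by rewrite !pos_pow_le0// addr0 powR_ge0.
- rewrite [X in X + _]pos_pow_le0// add0r pos_pow_dist// distrC.
  by apply: le_trans (ler_norm _); lra.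
- rewrite [X in _ + X]pos_pow_le0// addr0 pos_pow_dist//.
  by apply: le_trans (ler_norm _); lra.
- by exfalso; lra.
Qed.

End gap_estimates.

Lemma ge0_lee_poweR {R : realType} (r : R) (x y : \bar R) : 0 <= r ->
  (0 <= x)%E -> (x <= y)%E -> (x `^ r <= y `^ r)%E.
Proof.
move=> r0 x0 xy; apply: gt0_ler_poweR => //; rewrite in_itv/= leey andbT//.
exact: le_trans xy.
Qed.

(** * Functions whose variation is smaller than the height of g *)

Section deviation_from_monotone.
Context {R : realType}.
Local Notation mu := (@lebesgue_measure R).
Variables (a b al C A B : R) (g : R -> R).
Hypotheses (ab : a < b) (al0 : 0 < al) (C0 : 0 < C).
Hypothesis ndg : {in `]a, b[ &, {homo g : x y / x <= y}}.
Hypothesis gA : forall e, 0 < e -> exists2 x, x \in `]a, b[ & g x < A + e.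
Hypothesis gB : forall e, 0 < e -> exists2 x, x \in `]a, b[ & B - e < g x.
Hypothesis growth_a :
  forall x, x \in `]a, b[ -> g x - A <= C * (x - a) `^ al.
Hypothesis growth_b :
  forall x, x \in `]a, b[ -> B - g x <= C * (b - x) `^ al.

(** The growth bound at [b], evaluated where g is nearly [A]. It forces each lower profile to vanish
    beyond the opposite end, so its full beta integral fits in (a, b). *)
Let height_le : B - A <= C * (b - a) `^ al.
Proof.
apply/ler_addgt0Pr => e e0; have [x xab gx] := gA e0.
have := growth_b xab; have : C * (b - x) `^ al <= C * (b - a) `^ al.
  move: xab; rewrite in_itv/= => /andP[ax xb].
  by rewrite ler_pM2l// ge0_ler_powR ?nnegrE ?subr_ge0 ?lerD2l ?lerN2// ltW.
lra.
Qed.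

Section bounded_function.
Variables (u : R -> R) (m M : R).
Hypothesis umM : forall x, x \in `]a, b[ -> m <= u x <= M.
Hypothesis mM : m <= M.
Let h := B - A - (M - m).
Hypothesis h0 : 0 < h.

Let f x := u x - g x.

(* Near [a], [`|f|] is at least [h1 - C * (x - a) `^ al], near [b] at least
   [h2 - C * (b - x) `^ al], where [h1 + h2 = h]; convexity of [`^ (p + al^-1)]
   makes [h1 = h2] the worst case. *)
Lemma Lp_norm_ge_gap p : 1 <= p ->
  ((Kconst p al * C `^ (- al^-1) *
    (2 `^ (1 - (p + al^-1)) * h `^ (p + al^-1)))%:E
   <= Lp_norm a b p%:E f `^ p)%E.
Proof.
move=> p1; have p0 : 0 < p := lt_le_trans ltr01 p1.
have hBA : h <= B - A by rewrite /h gerBl subr_ge0.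
(* The misses m - A and B - M sum to h, but one may be negative: h2 is B - M clamped to [0, h], and
   h1 is the remainder. *)
have [h1 [h2 [h10 h20 h12 h1m h2M]]] : exists h1 h2, [/\ 0 <= h1, 0 <= h2,
    h1 + h2 = h, h1 <= Num.max 0 (m - A) & h2 <= Num.max 0 (B - M)].
  have hE : h = B - A - (M - m) by [].
  have [BM|BM] := leP (B - M) 0.
    exists h, 0; split; rewrite ?addr0 ?le_max ?lexx ?(ltW h0)//.
    by apply/orP; right; lra.
  have [BMh|BMh] := leP (B - M) h.
    exists (h - (B - M)), (B - M); split; rewrite ?subrK ?le_max ?lexx ?orbT//;
      by [rewrite subr_ge0|exact: ltW|apply/orP; right; lra].
  exists 0, h; split; rewrite ?add0r ?le_max ?lexx ?(ltW h0)//.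
  exact: ltW.
pose fa x := (pos_pow 0 (x - a) * pos_pow p (h1 - C * (x - a) `^ al))%:E.
pose fb x := (pos_pow 0 (b - x) * pos_pow p (h2 - C * (b - x) `^ al))%:E.
have fa0 x : (0 <= fa x)%E by rewrite lee_fin mulr_ge0 ?pos_pow_ge0.
have fb0 x : (0 <= fb x)%E by rewrite lee_fin mulr_ge0 ?pos_pow_ge0.
have mfa : measurable_fun setT fa.
  apply/measurable_EFinP.
  apply: (measurableT_comp (@measurable_ebeta R p al h1 C)).
  exact: measurable_funB.
have mfb : measurable_fun setT fb.
  apply/measurable_EFinP.
  apply: (measurableT_comp (@measurable_ebeta R p al h2 C)).
  exact: measurable_funB.
have q0 : 0 < al^-1 by rewrite invr_gt0.
have Iab : (\int[mu]_x (fa x + fb x) = (Kconst p al * C `^ (- al^-1) *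
    h1 `^ (p + al^-1))%:E + (Kconst p al * C `^ (- al^-1) *
    h2 `^ (p + al^-1))%:E)%E.
  apply: etrans (congr2 adde (ebeta_scale_left a p0 al0 h10 C0)
    (ebeta_scale_right b p0 al0 h20 C0)).
  exact: (ge0_integralD mu measurableT (fun x _ => fa0 x) mfa
    (fun x _ => fb0 x) mfb).
apply: (@le_trans _ _ (\int[mu]_x (fa x + fb x))%E).
  apply: (eq_ind_r (fun z => (_ <= z)%E) _ Iab).
  rewrite -EFinD lee_fin -mulrDr ler_wpM2l//.
    by rewrite mulr_ge0 ?powR_ge0// ltW// Kconst_gt0.
  by rewrite -h12 powR_half_sum// (le_trans p1)// lerDl ltW.
rewrite Lp_norm_powR ?gt_eqF//.
have fab0 x : (0 <= fa x + fb x)%E by exact: adde_ge0 (fa0 x) (fb0 x).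
apply: (le_integralT mu fab0) => x.
rewrite -EFinD lee_fin patchE mem_setE; case: ifPn => [xab|].
  move: (xab); rewrite in_itv/= => /andP[ax xb].
  have pos_pow01 y : 0 < y -> pos_pow 0 y = 1 :> R.
    by move=> y0; rewrite pos_powE// powRr0.
  have xa0 : 0 < x - a by rewrite subr_gt0.
  have bx0 : 0 < b - x by rewrite subr_gt0.
  rewrite (pos_pow01 _ xa0) (pos_pow01 _ bx0).
  rewrite [X in X + _]mul1r [X in _ + X]mul1r.
  apply: (pos_pow_dist_le p0 mM (umM xab)) => //.
  - exact: growth_a.
  - exact: growth_b.
  - by rewrite mulr_ge0 ?powR_ge0// ltW.
  - by rewrite mulr_ge0 ?powR_ge0// ltW.
  - exact: h1m.
  - exact: h2M.
(* Outside (a, b) the extended deviation is 0, so both profiles must vanish: one by its indicator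
   factor, the other by [height_le]. *)
rewrite in_itv/= negb_and -!leNgt => xab.
have zero c d y : 0 <= c <= h -> d = b - a -> d <= y ->
    pos_pow p (c - C * y `^ al) = 0.
  move=> /andP[c0 ch] -> bay; apply: pos_pow_le0; rewrite subr_le0.
  apply: (le_trans ch); apply: (le_trans hBA); apply: (le_trans height_le).
  rewrite ler_pM2l// ge0_ler_powR ?nnegrE ?(ltW al0)//.
    by rewrite subr_ge0 ltW.
  by apply: le_trans bay; rewrite subr_ge0 ltW.
have h1h : 0 <= h1 <= h by rewrite h10/= -h12 lerDl.
have h2h : 0 <= h2 <= h by rewrite h20/= -h12 lerDr.
case/orP: xab => [xa|bx].
  rewrite (@pos_pow_le0 _ 0 (x - a)) ?subr_le0// mul0r add0r.
  by rewrite (zero h2 _ (b - x) h2h erefl) ?mulr0 ?powR_ge0// lerD2l lerN2.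
rewrite (@pos_pow_le0 _ 0 (b - x)) ?subr_le0// mul0r addr0.
by rewrite (zero h1 _ (x - a) h1h erefl) ?mulr0 ?powR_ge0// lerD2r.
Qed.

(** As (m - A) + (B - M) = h, one of the two misses is at least h / 2. Near that end g is within [e]
    of its limit, and monotonicity keeps it so up to the end. *)
Lemma Lp_norm_pinfty_ge_gap : ((h / 2)%:E <= Lp_norm a b +oo f)%E.
Proof.
apply/lee_addgt0Pr => e e0; rewrite -leeBlDr//.
have [hBM|hmA] : h / 2 <= B - M \/ h / 2 <= m - A.
- have [?|?] := leP (h / 2) (B - M); [by left|right].
  by have hE : h = B - A - (M - m) by []; lra.
- have [y yab gy] := gB e0; move: (yab); rewrite in_itv/= => /andP[ay yb].
  apply: (@le_trans _ _ (Num.max 0 (h / 2 - e))%:E).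
    (* The truncation at 0 keeps the constant non-negative when e > h / 2, as [Lp_norm_pinfty_ge]
       requires. *)
    by rewrite -EFinB lee_fin le_max lexx orbT.
  apply: (@Lp_norm_pinfty_ge _ _ _ _ y b); rewrite ?le_max ?lexx// => x.
  rewrite in_itv/= => /andP[yx xb].
  have xab : x \in `]a, b[ by rewrite in_itv/= xb (lt_trans ay yx).
  split => //; rewrite ge_max normr_ge0 /f distrC/=.
  apply: le_trans (ler_norm _); have /andP[_ uM] := umM xab.
  by have := ndg yab xab (ltW yx); lra.
- have [y yab gy] := gA e0; move: (yab); rewrite in_itv/= => /andP[ay yb].
  apply: (@le_trans _ _ (Num.max 0 (h / 2 - e))%:E).
    by rewrite -EFinB lee_fin le_max lexx orbT.
  apply: (@Lp_norm_pinfty_ge _ _ _ _ a y); rewrite ?le_max ?lexx// => x.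
  rewrite in_itv/= => /andP[ax xy].
  have xab : x \in `]a, b[ by rewrite in_itv/= ax (lt_trans xy yb).
  split => //; rewrite ge_max normr_ge0 /f/=.
  apply: le_trans (ler_norm _); have /andP[mu_ _] := umM xab.
  by have := ndg xab yab (ltW xy); lra.
Qed.

End bounded_function.

(** What is saved in variation is more than paid back in fidelity; this yields both minimality of g
    and the exact variation of every minimizer. *)
Lemma TV_functional_gt gamma lambda (p : \bar R) (u : R -> R) :
  (1%:E <= p)%E -> 0 < gamma -> 0 < lambda -> gamma <= gamma_bound p al ->
  lambda_bound p al gamma C (B - A) < lambda ->
  (pointwise_TV `]a, b[ u < (B - A)%:E)%E ->
  ((B - A)%:E < TV_functional a b lambda gamma p g u)%E.
Proof.
move=> p1 ga0 la0 gale lale; rewrite /TV_functional.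
have cab : (a + b) / 2 \in `]a, b[ by rewrite in_itv/= !midf_lt.
have TV0 := pointwise_TV_ge0 u cab.
have TVu := dist_le_pointwise_TV u.
move: (pointwise_TV _ u) TV0 (TVu `]a, b[) => [T| |]// TV0 {}TVu TAB.
rewrite lee_fin in TV0; rewrite lte_fin in TAB.
(* The values of u lie in [M - T, M]. Using M - T instead of the infimum makes the gap exactly the
   deficit B - A - T. *)
pose M := sup (u @` `]a, b[).
have hs : has_sup (u @` `]a, b[).
  split; first by exists (u ((a + b) / 2)), ((a + b) / 2).
  exists (u ((a + b) / 2) + T) => _ [x xab <-].
  have := TVu _ _ xab cab; rewrite lee_fin => /(le_trans (ler_norm _)); lra.
have umM x : x \in `]a, b[ -> M - T <= u x <= M.
  move=> xab; apply/andP; split; last first.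
    by apply: ub_le_sup; [exact: hs.2|exists x].
  rewrite lerBlDr; apply: ge_sup; first exact: hs.1.
  move=> _ [y yab <-].
  have := TVu _ _ yab xab; rewrite lee_fin => /(le_trans (ler_norm _)); lra.
have mM : M - T <= M by rewrite gerBl.
have hE : B - A - (M - (M - T)) = B - A - T by congr (_ - _); ring.
have h0 : 0 < B - A - (M - (M - T)) by rewrite hE subr_gt0.
have hBA : B - A - T <= B - A by rewrite gerBl.
rewrite -lteBlDl// -EFinB.
move: p p1 gale lale => [p| |]// p1 gale lale.
- rewrite lee_fin in p1; have p0 : 0 < p := lt_le_trans ltr01 p1.
  have := Lp_norm_ge_gap umM mM h0 p1; rewrite hE => Nge.
  have := lambda_bound_gap p1 al0 ga0 C0 _ hBA gale lale.
  rewrite subr_gt0 => /(_ TAB) gap.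
  (* This splitting exposes the p-th power of the norm, for which the lower bound is stated. *)
  have -> : gamma = p * (gamma / p) by rewrite mulrCA divff ?mulr1// gt_eqF.
  rewrite poweRrM.
  apply: (@lt_le_trans _ _ (_%:E * (_%:E `^ (gamma / p)))%E).
    rewrite poweR_EFin -EFinM lte_fin; exact: gap.
  rewrite lee_pmul2l// ?lte_fin//; apply: ge0_lee_poweR => //.
    by rewrite divr_ge0 ?ltW.
  have K0 := ltW (Kconst_gt0 p0 al0).
  by rewrite lee_fin (mulr_ge0 (mulr_ge0 K0 _)) ?mulr_ge0 ?powR_ge0.
- have := Lp_norm_pinfty_ge_gap umM; rewrite hE => Nge.
  have := lambda_bound_gap_pinfty ga0 _ hBA gale lale.
  rewrite subr_gt0 => /(_ TAB) gap.
  apply: (@lt_le_trans _ _ (lambda%:E * ((B - A - T) / 2)%:E `^ gamma)%E).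
    by rewrite poweR_EFin -EFinM lte_fin.
  rewrite lee_pmul2l// ?lte_fin//; apply: ge0_lee_poweR => //.
    exact: ltW.
  by rewrite lee_fin divr_ge0// subr_ge0 ltW.
Qed.

End deviation_from_monotone.

(** * Uniqueness *)

Section near_minimizers.
Context {R : realType}.
Implicit Types (a b A B x y e : R) (f g u : R -> R).

Lemma bv_bounded a b g : a < b -> bv `]a, b[ g ->
  has_lbound (g @` `]a, b[) /\ has_ubound (g @` `]a, b[).
Proof.
move=> ab; rewrite /bv/= => TVg.
have cab : (a + b) / 2 \in `]a, b[ by rewrite in_itv/= !midf_lt.
have := pointwise_TV_ge0 g cab; have := @dist_le_pointwise_TV _ `]a, b[ g.
case: pointwise_TV TVg => [T| |]// _ gT _.
set c := (a + b) / 2.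
split; [exists (g c - T)|exists (g c + T)] => _ [x xab <-].
  have := gT _ _ cab xab; rewrite lee_fin -/c => /(le_trans (ler_norm _)); lra.
have := gT _ _ xab cab; rewrite lee_fin -/c => /(le_trans (ler_norm _)); lra.
Qed.

(** Otherwise |f| >= e on a whole interval, which gives a positive norm. No almost-everywhere
    statement about f is required. *)
Lemma Lp_norm_eq0_dense a b (p : \bar R) f y1 y2 e : (1%:E <= p)%E ->
  Lp_norm a b p f = 0%E -> a <= y1 -> y2 <= b -> y1 < y2 -> 0 < e ->
  exists2 z, z \in `]y1, y2[ & `|f z| < e.
Proof.
move=> p1 N0 ay1 y2b y12 e0; apply: contrapT => nz.
suff : (0 < Lp_norm a b p f)%E by rewrite N0 ltxx.
apply: (@Lp_norm_gt0 _ _ _ _ _ y1 y2 e) => // x xy; split.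
  by apply: subset_itvW xy.
by rewrite leNgt; apply/negP => fx; apply: nz; exists x.
Qed.

(* If [u x <> g x], then [u] goes from about [A] to about [B] through values
   close to [g x] just before and just after [x], so the detour to [u x] costs
   an additional variation of about [2 * `|u x - g x|]. *)
Lemma eq_of_pointwise_TV_le a b A B (p : \bar R) g u x : (1%:E <= p)%E ->
  Lp_norm a b p (fun z => u z - g z) = 0%E ->
  (pointwise_TV `]a, b[ u <= (B - A)%:E)%E ->
  {in `]a, b[ &, {homo g : y z / y <= z}} ->
  (forall y, y \in `]a, b[ -> A <= g y <= B) ->
  (forall c e, a < c -> 0 < e ->
     exists y, [/\ y \in `]a, b[, y < c & g y < A + e]) ->
  (forall c e, c < b -> 0 < e ->
     exists y, [/\ y \in `]a, b[, c < y & B - e < g y]) ->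
  x \in `]a, b[ ->
  (forall c e, c < x -> 0 < e ->
     exists y, [/\ y \in `]a, x[, c < y & g x - e < g y]) ->
  (forall c e, x < c -> 0 < e ->
     exists y, [/\ y \in `]x, b[, y < c & g y < g x + e]) ->
  u x = g x.
Proof.
move=> p1 N0 TVu ndg gAB gA gB xab gxl gxr; apply/eqP; rewrite -subr_eq0.
apply/negPn/negP => ugx.
(* The approximations below cost less than 8 e in total, while the detour gains 2 * 8 e. *)
pose e := `|u x - g x| / 8.
have e0 : 0 < e by rewrite divr_gt0// normr_gt0.
have ue : `|u x - g x| = 8 * e by rewrite /e; field.
move: (xab); rewrite in_itv/= => /andP[ax xb].
have dense y1 y2 : a <= y1 -> y2 <= b -> y1 < y2 ->
    exists2 z, z \in `]y1, y2[ & `|u z - g z| < e.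
  by move=> ? ? ?; exact: (Lp_norm_eq0_dense p1 N0).
(* Each y_i fixes the level of g up to e (A, g(x), g(x), B); each z_i is a nearby point where u is
   within e of g, on the side of y_i to which monotonicity carries the required bound. *)
have [y1 [y1ab y1x gy1]] := gA x e ax e0.
have ay1 : a < y1 by move: y1ab; rewrite in_itv/= => /andP[].
have [z1] := dense a y1 (lexx a) (ltW (lt_trans y1x xb)) ay1.
rewrite in_itv/= => /andP[az1 z1y1] uz1.
have z1x := lt_trans z1y1 y1x.
have [y2 [y2ax z1y2 gy2]] := gxl z1 e z1x e0.
have y2x : y2 < x by move: y2ax; rewrite in_itv/= => /andP[].
have ay2 := lt_trans az1 z1y2.
have [z2] := dense y2 x (ltW ay2) (ltW xb) y2x.
rewrite in_itv/= => /andP[y2z2 z2x] uz2.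
have [y4 [y4ab xy4 gy4]] := gB x e xb e0.
have y4b : y4 < b by move: y4ab; rewrite in_itv/= => /andP[].
have [z4] := dense y4 b (ltW (lt_trans ax xy4)) (lexx b) y4b.
rewrite in_itv/= => /andP[y4z4 z4b] uz4.
have xz4 := lt_trans xy4 y4z4.
have [y3 [y3xb y3z4 gy3]] := gxr z4 e xz4 e0.
have xy3 : x < y3 by move: y3xb; rewrite in_itv/= => /andP[].
have [z3] := dense x y3 (ltW ax) (ltW (lt_trans y3z4 z4b)) xy3.
rewrite in_itv/= => /andP[xz3 z3y3] uz3.
have z12 := lt_trans z1y2 y2z2.
have z34 := lt_trans z3y3 y3z4.
have inab z : a < z -> z < b -> z \in `]a, b[.
  by move=> ? ?; rewrite in_itv/=; apply/andP.
have z1ab : z1 \in `]a, b[ by apply: inab => //; exact: lt_trans z1x xb.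
have y2ab : y2 \in `]a, b[ by apply: inab => //; exact: lt_trans y2x xb.
have z2ab : z2 \in `]a, b[.
  by apply: inab; [exact: lt_trans az1 z12|exact: lt_trans z2x xb].
have y3ab : y3 \in `]a, b[.
  by apply: inab; [exact: lt_trans ax xy3|exact: lt_trans y3z4 z4b].
have z3ab : z3 \in `]a, b[.
  by apply: inab; [exact: lt_trans ax xz3|exact: lt_trans z34 z4b].
have z4ab : z4 \in `]a, b[ by apply: inab => //; exact: lt_trans ax xz4.
have g1 := ndg _ _ z1ab y1ab (ltW z1y1).
have g2 := ndg _ _ y2ab z2ab (ltW y2z2).
have g2x := ndg _ _ z2ab xab (ltW z2x).
have gx3 := ndg _ _ xab z3ab (ltW xz3).
have g3 := ndg _ _ z3ab y3ab (ltW z3y3).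
have g4 := ndg _ _ y4ab z4ab (ltW y4z4).
have := @pointwise_TV_path _ `]a, b[ u z1 [:: z2; x; z3; z4].
rewrite /= z1ab z2ab xab z3ab z4ab (ltW z12) (ltW z2x) (ltW xz3) (ltW z34).
move=> /(_ erefl erefl)/le_trans/(_ TVu); rewrite lee_fin.
rewrite !big_ord_recr big_ord0/= add0r.
move: uz1 uz2 uz3 uz4; rewrite !ltr_norml.
move=> /andP[? ?] /andP[? ?] /andP[? ?] /andP[? ?].
have norm_geN (v : R) : - v <= `|v| by rewrite -normrN ler_norm.
have := ler_norm (u z2 - u z1); have := ler_norm (u z4 - u z3).
(* The terms at x are signed according to whether u dips below or rises above g there: z2 supplies
   the estimate in the first case, z3 in the second. *)
have [ux|ux] := leP (u x) (g x).
  have := ler_norm (u z3 - u x); have := norm_geN (u x - u z2).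
  by move: ue; rewrite ler0_norm ?subr_le0//; lra.
have := norm_geN (u z3 - u x); have := ler_norm (u x - u z2).
by move: ue; rewrite gtr0_norm ?subr_gt0//; lra.
Qed.

End near_minimizers.

(** * Minimality of g, and agreement of all minimizers off its jump set *)

Theorem theorem3p8 (R : realType) (a b lambda gamma : R) (p : \bar R)
    (g : R -> R) (alpha C : R)
    (hab : a < b) (hlambda : 0 < lambda) (hgamma : 0 < gamma)
    (hp : (1%:E <= p)%E)
    (hg : bv_reg a b g)
    (hmono : {in `]a, b[ &, {homo g : x y / x <= y}})
    (halpha : 0 < alpha) (hC : 0 < C)
    (hgrowth_a : forall x, x \in `]a, b[ ->
       g x - right_lim g a <= C * (x - a) `^ alpha)
    (hgrowth_b : forall x, x \in `]a, b[ ->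
       left_lim g b - g x <= C * (b - x) `^ alpha)
    (hgamma_le : gamma <= gamma_bound p alpha)
    (hlambda_gt : lambda_bound p alpha gamma C (height a b g) < lambda) :
  let F := TV_functional a b lambda gamma p g in
  is_minimizer (bv `]a, b[) F g /\
  (forall u, is_minimizer (bv `]a, b[) F u ->
     forall x, x \in `]a, b[ -> ~ jump_set a b g x -> u x = g x).
Proof.
move=> F; have [bvg regg] := hg.
have [lbg ubg] := bv_bounded hab bvg.
have [gB_ub gB] := left_lim_sup hab hmono ubg.
have [gA_lb gA] := right_lim_inf hab hmono lbg.
move: hlambda_gt; rewrite /height.
set A := right_lim g a in gA gA_lb hgrowth_a *.
set B := left_lim g b in gB gB_ub hgrowth_b * => hlambda_gt.
have gAB x : x \in `]a, b[ -> A <= g x <= B.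
  by move=> xab; rewrite gA_lb// gB_ub.
have gA' e : 0 < e -> exists2 x, x \in `]a, b[ & g x < A + e.
  by move=> e0; have [y [? _ ?]] := gA b e hab e0; exists y.
have gB' e : 0 < e -> exists2 x, x \in `]a, b[ & B - e < g x.
  by move=> e0; have [y [? _ ?]] := gB a e hab e0; exists y.
have gap u := @TV_functional_gt R a b alpha C A B g hab halpha hC hmono
  gA' gB' hgrowth_a hgrowth_b gamma lambda p u hp hgamma hlambda hgamma_le
  hlambda_gt.
have dev_ge0 u :
    (0 <= lambda%:E * Lp_norm a b p (fun x => u x - g x)%R `^ gamma)%E.
  by rewrite mule_ge0 ?poweR_ge0// lee_fin ltW.
(* Either the variation alone reaches the height, or the gap estimate applies. *)
have Fge u : ((B - A)%:E <= F u)%E.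
  have [TVu|/gap/ltW//] := leP (B - A)%:E (pointwise_TV `]a, b[ u).
  by rewrite /F /TV_functional (le_trans TVu)// leeDl.
have Fg : (F g <= (B - A)%:E)%E.
  have pn0 : p != 0%E by rewrite gt_eqF// (lt_le_trans _ hp).
  rewrite /F /TV_functional.
  have -> : Lp_norm a b p (fun x => g x - g x) = 0%E.
    rewrite /Lp_norm -[RHS](Lnorm0 (@lebesgue_measure R) pn0).
    apply: eq_Lnorm => x /=; rewrite patchE.
    by case: ifP => // _; rewrite subrr.
  rewrite poweR0r ?gt_eqF// mule0 adde0.
  exact: pointwise_TV_monotone.
split=> [|u [bvu minu] x xab xnj].
  by split=> // v _; exact: le_trans Fg (Fge v).
have Fu : (F u <= (B - A)%:E)%E by exact: le_trans (minu g bvg) Fg.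
have TVu : ((B - A)%:E <= pointwise_TV `]a, b[ u)%E.
  by rewrite leNgt; apply/negP => /gap; rewrite ltNge Fu.
have TVu_le : (pointwise_TV `]a, b[ u <= (B - A)%:E)%E.
  by apply: le_trans Fu; rewrite /F /TV_functional leeDl.
have TVuE : pointwise_TV `]a, b[ u = (B - A)%:E.
  by apply/eqP; rewrite eq_le TVu_le.
(* The variation already uses up the minimal value B - A, which leaves nothing for the fidelity
   term. *)
have N0 : Lp_norm a b p (fun x => u x - g x) = 0%E.
  move: Fu; rewrite /F /TV_functional TVuE -leeBrDl// subee//.
  rewrite pmule_rle0 ?lte_fin// => N0.
  apply: (@poweR_eq0_eq0 _ _ gamma); first exact: Lnorm_ge0.
  by apply/eqP; rewrite eq_le N0 poweR_ge0.
have xjE : left_lim g x = right_lim g x by apply: contrapT => ?; apply: xnj.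
(* With equal one-sided limits, regularity pins g(x) to their common value, so g(x) is approached
   from both sides. *)
have := regg _ xab; rewrite xjE minxx maxxx -eq_le eq_sym => /eqP gx.
move: (xab); rewrite in_itv/= => /andP[ax xb].
apply: (eq_of_pointwise_TV_le hp N0 TVu_le hmono gAB gA gB xab).
- rewrite gx -xjE; apply: (left_lim_sup ax _ _).2.
    by move=> y z yax zax; apply: hmono; [apply: subset_itvl yax|
      apply: subset_itvl zax]; rewrite bnd_simp ltW.
  case: ubg => M gM; exists M => _ [y yax <-]; apply: gM; exists y => //.
  by apply: subset_itvl yax; rewrite bnd_simp ltW.
- rewrite gx; apply: (right_lim_inf xb _ _).2.
    by move=> y z yxb zxb; apply: hmono; [apply: subset_itvr yxb|
      apply: subset_itvr zxb]; rewrite bnd_simp ltW.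
  case: lbg => M gM; exists M => _ [y yxb <-]; apply: gM; exists y => //.
  by apply: subset_itvr yxb; rewrite bnd_simp ltW.
Qed.
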